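(* Let $X$ be countably infinite, $X=\omega$. Then $Pol(T_1)$ is a Borel set in the topological space $\mathscr{O}$.
   Context: $X=\omega$ with its usual order. $\mathscr{O}^{(n)}$ is the set of all functions $X^n\to X$ and $\mathscr{O}=\bigcup_{n\ge 1}\mathscr{O}^{(n)}$. Topology on $\mathscr{O}$: equip $X=\omega$ with the discrete topology, $\mathscr{O}^{(n)}=\omega^{\omega^n}$ with the product topology (so it is homeomorphic to the Baire space), and $\mathscr{O}$ with the topology of the disjoint sum of the spaces $\mathscr{O}^{(n)}$, $n\ge 1$. A function $f\in\mathscr{O}^{(n)}$ is almost unary iff there are $F\in\mathscr{O}^{(1)}$ and $1\le k\le n$ with $f(x_1,\dots,x_n)<F(x_k)$ for all $(x_1,\dots,x_n)\in X^n$. $T_1$ is the set of all binary almost unary functions. $Pol(T_1)$ is the set of all $f\in\mathscr{O}$ (of any arity $n$) such that for all $g_1,\dots,g_n\in T_1$ the composite $f(g_1,\dots,g_n)$ is in $T_1$. *)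

(* Defs.v *)
From mathcomp Require Import all_boot all_order all_classical all_analysis.

Set Implicit Arguments.
Unset Strict Implicit.
Unset Printing Implicit Defensive.

Local Open Scope classical_set_scope.

(* The n-ary operations on omega, with the product topology; the topology on
   nat in the library is the discrete one. *)
Definition oper (n : nat) : topologicalType := {ptws n.-tuple nat -> nat}.

(* The operations of all arities n >= 1: the component of index n consists of
   the operations of arity n.+1. The topology on a sigT type is that of the
   disjoint sum. *)
Definition operations : topologicalType := {n : nat & oper n.+1}.

Definition almost_unary n (f : oper n) : Prop :=
  exists (F : nat -> nat) (k : 'I_n),
    forall x : n.-tuple nat, (f x < F (tnth x k))%N.

Definition T1 : set (oper 2) := [set g | almost_unary g].

Definition compose n m (f : oper n) (g : 'I_n -> oper m) : oper m :=
  fun x => f [tuple g i x | i < n].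

Definition Pol m (C : set (oper m)) : set operations :=
  [set f : operations | forall g : 'I_(tag f).+1 -> oper m,
    (forall i, C (g i)) -> C (@compose (tag f).+1 m (tagged f) g)].

Definition Borel (T : topologicalType) (A : set T) : Prop :=
  <<s [set U : set T | open U] >> A.

(* Main.v *)
(* An operation f of arity n is in Pol T1 iff for every set A of coordinates,
   f is bounded by a function of the coordinates in A, or by a function of the
   coordinates outside A. For sufficiency, let A be the set of the i such that
   g_i(x, y) is bounded in terms of x. For necessity, let c^j and d^j be
   arguments with f(c^j), f(d^j) > j such that the c^j are bounded by m on A and
   the d^j are bounded by m outside A; almost unary g_i with
   (g_i(0, y))_i = c^y and (g_i(x, 0))_i = d^x for x, y > 0 then make
   f(g_1, ..., g_n) unbounded on both axes. The criterion only quantifies over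
   countable sets, so it describes a Borel set. *)

From mathcomp Require Import all_boot all_classical all_analysis.
Require Import Defs.

Set Implicit Arguments.
Unset Strict Implicit.
Unset Printing Implicit Defensive.

Local Open Scope classical_set_scope.

Section Borel.
Variable T : topologicalType.
Implicit Types A B : set T.

Lemma open_Borel A : open A -> Borel A.
Proof. by move=> oA; exact: sub_gen_smallest. Qed.

Lemma BorelC A : Borel A -> Borel (~` A).
Proof.
rewrite -setTD.
by case: (@smallest_sigma_algebra _ setT [set U : set T | open U]) => _ + _; exact.
Qed.

Lemma Borel_exists (I : countType) (P : I -> set T) :
  (forall i, Borel (P i)) -> Borel [set x | exists i, P i x].
Proof.
move=> BP; have -> : [set x | exists i, P i x] =
    \bigcup_n (if @unpickle I n is Some i then P i else set0).
  apply/seteqP; split=> x /=; last first.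
    by case=> n _; case: unpickle => // i Pix; exists i.
  by case=> i Pix; exists (pickle i) => //; rewrite pickleK.
apply: sigma_algebra_bigcup => n; case: unpickle => [i|]; first exact: BP.
by apply: open_Borel; exact: open0.
Qed.

Lemma Borel_forall (I : countType) (P : I -> set T) :
  (forall i, Borel (P i)) -> Borel [set x | forall i, P i x].
Proof.
move=> BP; have -> : [set x | forall i, P i x] =
    ~` [set x | exists i, (~` P i) x].
  apply/seteqP; split=> x /= Px; first by case=> i []; exact: Px.
  by move=> i; apply: contrapT => nPix; apply: Px; exists i.
by apply: BorelC; apply: Borel_exists => i; exact: BorelC.
Qed.

Lemma BorelU A B : Borel A -> Borel B -> Borel (A `|` B).
Proof.
move=> BA BB; have -> : A `|` B = [set x | exists b : bool, (if b then A else B) x].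
  apply/seteqP; split=> x /=; first by case; [exists true | exists false].
  by case=> -[]; [left | right].
by apply: Borel_exists => -[].
Qed.

End Borel.

(** This expresses that [f] is bounded by a function of the coordinates in [p], with number
    quantifiers only: such a function has a maximum on each finite box, and conversely [N] taken at
    the largest of these coordinates is such a function. *)
Definition bounded_on n (f : oper n) (p : pred nat) : Prop :=
  forall m, exists N, forall x : n.-tuple nat,
    (forall i : 'I_n, p i -> (tnth x i <= m)%N) -> (f x <= N)%N.

(** Once coordinate [k] has the value [u], every [g i] with [p i] stays below the maximum of the
    [F i u], which bounds the composite in terms of [u]. *)
Lemma compose_almost_unary n m (f : oper n) (g : 'I_n -> oper m) (p : pred nat)
    (k : 'I_m) (F : 'I_n -> nat -> nat) :
    (forall i : 'I_n, p i -> forall x, (g i x < F i (tnth x k))%N) ->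
  bounded_on f p -> almost_unary (compose f g).
Proof.
move=> gF /choice[N fN].
exists (fun u => (N (\max_(i < n) F i u)).+1), k => x.
rewrite ltnS; apply: fN => i pi; rewrite tnth_mktuple.
exact/(leq_trans (ltnW (gF i pi x)))/(leq_bigmax (F := F ^~ (tnth x k))).
Qed.

Lemma not_bounded_on n (f : oper n) (p : pred nat) :
  ~ bounded_on f p -> exists m (c : nat -> n.-tuple nat), forall j,
    (forall i : 'I_n, p i -> (tnth (c j) i <= m)%N) /\ (j < f (c j))%N.
Proof.
move=> /existsNP[m /forallNP nb]; exists m.
suff /choice[c cP] : forall j, exists x : n.-tuple nat,
    (forall i : 'I_n, p i -> (tnth x i <= m)%N) /\ (j < f x)%N by exists c.
move=> j; have /existsNP[x /not_implyP[xm /negP]] := nb j.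
by rewrite -ltnNge; exists x.
Qed.

Lemma compose_not_T1 n (f : oper n) (p : pred nat) :
    ~ bounded_on f p -> ~ bounded_on f (predC p) ->
  exists g : 'I_n -> oper 2, (forall i, T1 (g i)) /\ ~ T1 (compose f g).
Proof.
move=> /not_bounded_on[m [c cP]] /not_bounded_on[m' [d dP]].
pose x0 (x : 2.-tuple nat) := tnth x ord0.
pose x1 (x : 2.-tuple nat) := tnth x ord_max.
(* Off the axes, [g i] takes a value of [d] if [p i] and of [c] otherwise. So for [p i] the values
   of [c], at most [m], are the only ones that depend on the second variable; outside [p] the roles
   are exchanged. *)
pose g (i : 'I_n) : oper 2 := fun x =>
  if p i then if x0 x == 0 then tnth (c (x1 x)) i else tnth (d (x0 x)) i
  else if x1 x == 0 then tnth (d (x0 x)) i else tnth (c (x1 x)) i.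
exists g; split=> [i|].
  rewrite /T1 /= /almost_unary /g; case pi: (p i).
    exists (fun u => (m + tnth (d u) i).+1), ord0 => x; rewrite ltnS -/(x0 x).
    case: eqP => _; last exact: leq_addl.
    exact/(leq_trans ((cP _).1 i pi))/leq_addr.
  exists (fun u => (m' + tnth (c u) i).+1), ord_max => x; rewrite ltnS -/(x1 x).
  case: eqP => _; last exact: leq_addl.
  by apply: leq_trans ((dP _).1 i _) (leq_addr _ _); rewrite /= pi.
have gc y : compose f g [tuple 0; y.+1] = f (c y.+1).
  congr f; apply/eq_from_tnth => i; rewrite tnth_mktuple /g /x0 /x1 !(tnth_nth 0).
  by case: ifP.
have gd y : compose f g [tuple y.+1; 0] = f (d y.+1).
  congr f; apply/eq_from_tnth => i; rewrite tnth_mktuple /g /x0 /x1 !(tnth_nth 0).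
  by case: ifP.
(* On the axis where variable [k] is 0 the bound is the constant [F 0], which the point at distance
   [(F 0).+1] exceeds. *)
case=> F [k Fk]; have [k0|k1] := eqVneq k ord0.
  have := Fk [tuple 0; (F 0).+1]; rewrite k0 gc (tnth_nth 0) /=.
  by move/(ltn_trans (cP (F 0).+1).2); rewrite ltnNge leqnSn.
have k_max : k = ord_max by apply/val_inj; case: k k1 {Fk} => -[|[]].
have := Fk [tuple (F 0).+1; 0]; rewrite k_max gd (tnth_nth 0) /=.
by move/(ltn_trans (dP (F 0).+1).2); rewrite ltnNge leqnSn.
Qed.

Lemma Pol_T1P (f : operations) :
  Pol T1 f <-> forall A : seq nat,
    bounded_on (tagged f) (mem A) \/ bounded_on (tagged f) (predC (mem A)).
Proof.
split=> [fP A|fA g].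
  apply: contrapT => /not_orP[nA nAC].
  by have [g [gT1 /(_ (fP g gT1))]] := compose_not_T1 nA nAC.
move=> /choice[F /choice[k gF]].
(* The list collects the [i] for which [g i] is bounded through the first variable; all others are
   bounded through the second. *)
have [fb|fb] := fA [seq val i | i <- enum 'I_(tag f).+1 & k i == ord0].
  apply: (compose_almost_unary (k := ord0) (F := F)) fb => i.
  rewrite /= mem_map; last exact: val_inj.
  by rewrite mem_filter => /andP[/eqP <-] _; exact: gF.
apply: (compose_almost_unary (k := ord_max) (F := F)) fb => i.
rewrite /= mem_map; last exact: val_inj.
rewrite mem_filter mem_enum andbT => ki.
have <- : k i = ord_max by apply/val_inj; case: (k i) ki => -[|[]].
exact: gF.
Qed.

(** On each component, evaluation at a fixed tuple is a continuous projection to a discrete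
    space. *)
Lemma open_operations_at (t : forall n, n.-tuple nat) (Q : nat -> nat -> Prop) :
  open [set f : operations | Q (tag f) (tagged f (t (tag f).+1))].
Proof.
apply/sigT_openP => n.
rewrite (_ : _ @^-1` _ = proj (t n.+1) @^-1` Q n) //.
apply: open_comp; last exact: discrete_open.
by move=> f _; exact: proj_continuous.
Qed.

Lemma Borel_bounded_on (p : pred nat) :
  Borel [set f : operations | bounded_on (tagged f) p].
Proof.
apply: Borel_forall => m; apply: Borel_exists => N.
(* Cutting [s] to length [n] or padding it with zeros yields every [n]-tuple, so one countable index
   type serves all arities. *)
pose t (s : seq nat) n := [tuple nth 0 s i | i < n].
pose small (s : seq nat) n :=
  forall i : 'I_n, p i -> (tnth (t s n) i <= m)%N.
rewrite [X in Borel X](_ : _ = [set f : operations | forall s : seq nat,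
    small s (tag f).+1 -> (tagged f (t s (tag f).+1) <= N)%N]).
  apply: Borel_forall => s; apply: open_Borel.
  exact: (open_operations_at (t := t s) (Q := fun n y => small s n.+1 -> (y <= N)%N)).
apply/seteqP; split=> f /= fN => [s|x]; first exact: fN.
have -> : x = t x (tag f).+1.
  by apply/eq_from_tnth => i; rewrite tnth_mktuple (tnth_nth 0).
exact: fN.
Qed.

Theorem theorem13 : Borel (Pol T1).
Proof.
rewrite (_ : Pol T1 = [set f : operations | forall A : seq nat,
    ([set f : operations | bounded_on (tagged f) (mem A)] `|`
     [set f : operations | bounded_on (tagged f) (predC (mem A))]) f]).
  by apply: Borel_forall => A; apply: BorelU; exact: Borel_bounded_on.
by apply/seteqP; split=> f /Pol_T1P.
Qed.
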